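(* Let $H$ be a separable infinite-dimensional complex Hilbert space. There does not exist an absolutely convergent frame for $H$.
   Context: A sequence $\{x_n\}_{n\in\mathbb{N}}$ in $H$ is a frame for $H$ if there are constants $0<A\le B$ with $A\|x\|^2\le\sum_n|\langle x,x_n\rangle|^2\le B\|x\|^2$ for all $x\in H$. An alternative dual for $\{x_n\}$ is any sequence $\{y_n\}$ in $H$ such that $x=\sum_n\langle x,y_n\rangle x_n$ (convergence in the norm of $H$) for every $x\in H$. For $1\le p\le 2$, a frame $\{x_n\}$ is $p$-convergent if it has an alternative dual $\{y_n\}$ such that $\sum_n\|\langle x,y_n\rangle x_n\|^p<\infty$ for every $x\in H$. An absolutely convergent frame is a $1$-convergent frame. *)

(* Defs.v *)
From HB Require Import structures.
From mathcomp Require Import all_boot all_order all_algebra.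
From mathcomp Require Import complex.
From mathcomp Require Import all_classical all_reals all_analysis.

Set Implicit Arguments.
Unset Strict Implicit.
Unset Printing Implicit Defensive.

Import Order.TTheory GRing.Theory Num.Theory.
Import numFieldNormedType.Exports.

Local Open Scope classical_set_scope.
Local Open Scope ring_scope.
Local Open Scope complex_scope.

(* A complex Hilbert space is a complete normed module [H] over [R[i]] with an
   inner product [ip : {dot H for conjC}] that induces its norm.  Such forms
   are linear in the first argument and conjugate-linear in the second. *)
Definition induces_norm (R : realType) (H : completeNormedModType R[i])
    (ip : {dot H for @Num.conj R[i]}) : Prop :=
  forall x : H, `|x| ^+ 2 = ip x x.

Definition separable_space (T : topologicalType) : Prop :=
  exists D : set T, countable D /\ dense D.

(* No finite family spans [V]. *)
Definition infinite_dimensional (K : fieldType) (V : lmodType K) : Prop :=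
  forall s : seq V, exists x : V,
    forall c : 'I_(size s) -> K, x <> \sum_(i < size s) c i *: s`_i.

(* Norms over [R[i]] are valued in [R[i]], where [0 <= z] means that [z] is
   real and nonnegative: taking the real part loses nothing. *)
Definition rnorm (R : realType) (V : normedZmodType R[i]) (x : V) : R :=
  complex.Re `|x|.

(* Series of nonnegative terms are taken in [\bar R], so that the upper bound
   below includes convergence. *)
Definition frame (R : realType) (H : completeNormedModType R[i])
    (ip : {dot H for @Num.conj R[i]}) (x_ : nat -> H) : Prop :=
  exists A B : R, [/\ 0 < A, A <= B &
    forall x : H,
      ((A * rnorm x ^+ 2)%:E <=
         \sum_(0 <= n <oo) (rnorm (ip x (x_ n)) ^+ 2)%:E)%E /\
      (\sum_(0 <= n <oo) (rnorm (ip x (x_ n)) ^+ 2)%:E <=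
         (B * rnorm x ^+ 2)%:E)%E].

Definition alternative_dual (R : realType) (H : completeNormedModType R[i])
    (ip : {dot H for @Num.conj R[i]}) (x_ y_ : nat -> H) : Prop :=
  forall x : H, series (fun n => ip x (y_ n) *: x_ n) @ \oo --> x.

Definition p_convergent_frame (R : realType) (H : completeNormedModType R[i])
    (ip : {dot H for @Num.conj R[i]}) (p : R) (x_ : nat -> H) : Prop :=
  [/\ 1 <= p <= 2, frame ip x_ &
    exists2 y_ : nat -> H, alternative_dual ip x_ y_ &
      forall x : H,
        (\sum_(0 <= n <oo) (rnorm (ip x (y_ n) *: x_ n) `^ p)%:E < +oo)%E].

Definition absolutely_convergent_frame (R : realType)
    (H : completeNormedModType R[i]) (ip : {dot H for @Num.conj R[i]})
    (x_ : nat -> H) : Prop :=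
  p_convergent_frame ip 1 x_.

(* Main.v *)
Require Import Defs.
From mathcomp Require Import all_boot all_order all_algebra.
From mathcomp Require Import complex.
From mathcomp Require Import all_classical all_reals all_analysis.
From mathcomp Require Import ring lra.

Import Order.TTheory GRing.Theory Num.Theory.
Import numFieldNormedType.Exports.

Local Open Scope classical_set_scope.
Local Open Scope ring_scope.
Local Open Scope complex_scope.

(** The argument is a gliding hump. Let [y_] be a dual of [x_] such that the
    terms [ip v (y_ n) *: x_ n] are absolutely summable for every [v]; write
    [G v n] for their norms, so that [\sum_n G v n] is finite and dominates
    the norm of [v].

    Since only finitely many linear constraints are imposed at each stage and
    [H] is infinite-dimensional ([orthogonal_unit]), unit vectors [e k] and
    indices [N k] can be chosen inductively ([gliding_hump_step]) so that
    - [e k] is orthogonal to the previous [e j] and to [y_ n] for [n < N k];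
    - the terms [G (e k) n] with [N k <= n < N k.+1] add up to at least 1/2,
      as the norm of [e k] is 1 and the terms below [N k] vanish;
    - the partial sum of order [k] of the series with terms [e k / (k + 1)]
      has a tail of [G] at most [1 / (4 (k + 1))] beyond [N k].
    The series of the [e k / (k + 1)] is orthogonal with square summable
    coefficients, hence it converges to some [x] by completeness
    ([harmonic_orthonormal_cvg]). The terms of [G x] of index less than
    [N k.+1] only see the partial sum of order [k.+1], so the block of [G x]
    between [N k] and [N k.+1] is at least
    [1 / (2 (k + 1)) - 1 / (4 (k + 1)) = 1 / (4 (k + 1))]. Summing the
    blocks, the divergence of the harmonic series contradicts the summability
    of [G x]. *)

(** * Real-valued norms *)

Section RealNorm.
Context {R : realType}.

Lemma rnormE (V : normedZmodType R[i]) (x : V) : `|x| = (rnorm x)%:C.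
Proof.
have : 0 <= `|x| by [].
by rewrite /rnorm; case: `|x| => a b; rewrite lecE /= => /andP[/eqP-> _].
Qed.

Lemma rnorm_ge0 (V : normedZmodType R[i]) (x : V) : 0 <= rnorm x.
Proof. by rewrite -(@lecR R) -rnormE; exact: normr_ge0. Qed.

Lemma ler_rnormD (V : normedZmodType R[i]) (x y : V) :
  rnorm (x + y) <= rnorm x + rnorm y.
Proof. by rewrite -(@lecR R) rmorphD /= -!rnormE ler_normD. Qed.

Lemma lerB_rnormD (V : normedZmodType R[i]) (x y : V) :
  rnorm x - rnorm y <= rnorm (x + y).
Proof.
rewrite lerBlDr -{1}(addrK y x) (le_trans (ler_rnormD _ _ _))//.
by rewrite /rnorm normrN.
Qed.

Lemma rnormZ (V : normedModType R[i]) (r : R) (x : V) : 0 <= r ->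
  rnorm (r%:C *: x) = r * rnorm x.
Proof.
move=> r0; apply: (@complexI R).
rewrite -rnormE normrZ ger0_norm ?lecR// rnormE.
by rewrite [RHS]rmorphM.
Qed.

Lemma rnorm_sum (V : normedZmodType R[i]) (I : Type) (r : seq I) (P : pred I)
    (F : I -> V) :
  rnorm (\sum_(i <- r | P i) F i) <= \sum_(i <- r | P i) rnorm (F i).
Proof.
by rewrite -(@lecR R) rmorph_sum /= -rnormE (le_trans (ler_norm_sum _ _ _))//;
   apply: ler_sum => i _; rewrite rnormE.
Qed.

End RealNorm.

(** * Inner products and orthogonality *)

Section InnerProduct.
Context {R : realType} {H : completeNormedModType R[i]}.
Context {ip : {dot H for @Num.conj R[i]}} (ip_norm : induces_norm ip).

Lemma ipZl a (u v : H) : ip (a *: u) v = a * ip u v.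
Proof. by rewrite linearZl_LR. Qed.

Lemma ipZr a (u v : H) : ip u (a *: v) = Num.conj a * ip u v.
Proof. by rewrite linearZr_LR. Qed.

Lemma ipDl (u v w : H) : ip (u + v) w = ip u w + ip v w.
Proof. exact: linearDl. Qed.

Lemma ipBl (u v w : H) : ip (u - v) w = ip u w - ip v w.
Proof. exact: linearBl. Qed.

Lemma ipBr (u v w : H) : ip w (u - v) = ip w u - ip w v.
Proof. exact: linearBr. Qed.

Lemma ip_suml (m n : nat) (F : nat -> H) (v : H) :
  ip (\sum_(m <= k < n) F k) v = \sum_(m <= k < n) ip (F k) v.
Proof. exact: linear_sumlz. Qed.

Lemma ip_pythagoras (u v : H) :
  ip u v = 0 -> ip (u + v) (u + v) = ip u u + ip v v.
Proof. exact: hnormDd. Qed.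

Lemma ip_conj (u v : H) : ip v u = Num.conj (ip u v).
Proof. by rewrite (hermC ip v u) expr0 mul1r. Qed.

Lemma ip_cauchy_schwarz (u v : H) : `|ip u v| <= `|u| * `|v|.
Proof.
have [->|v0] := eqVneq v 0; first by rewrite linear0r !normr0 mulr0.
have q0 : 0 < ip v v by rewrite -ip_norm exprn_gt0// normr_gt0.
set a := ip u v / ip v v.
have : 0 <= ip (u - a *: v) (u - a *: v) by rewrite -ip_norm exprn_ge0.
have -> : ip (u - a *: v) (u - a *: v) = ip u u - `|ip u v| ^+ 2 / ip v v.
  rewrite ipBl !ipBr !ipZl !ipZr (ip_conj u v) normCK.
  have -> : Num.conj a = Num.conj (ip u v) / ip v v.
    rewrite /a rmorphM fmorphV; congr (_ / _).
    by apply: CrealP; exact: gtr0_real.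
  by rewrite /a; field; exact: lt0r_neq0.
rewrite subr_ge0 ler_pdivrMr// -!ip_norm -exprMn ler_pXn2r//.
by rewrite nnegrE mulr_ge0.
Qed.

(** Continuity of the inner product in its first argument, for sequences whose
    inner products with [y] are eventually constant. *)
Lemma ip_cvg_const (s : nat -> H) (x y : H) (c : R[i]) (k : nat) :
  s @ \oo --> x -> (forall m, (k <= m)%N -> ip (s m) y = c) -> ip x y = c.
Proof.
move=> sx sc; apply/eqP; rewrite -subr_eq0 -normr_le0.
apply/ler_addgt0Pl => e e0; rewrite addr0.
have d0 : 0 < e / (`|y| + 1) by rewrite divr_gt0// ltr_wpDl.
have /cvgrPdist_lt/(_ _ d0)[N _ HN] := sx.
have := HN (maxn N k) (leq_maxl _ _) => /= lt1.
rewrite -(sc (maxn N k)) ?leq_maxr// -ipBl.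
apply: (le_trans (ip_cauchy_schwarz _ _)).
rewrite (le_trans (ler_wpM2r (normr_ge0 _) (ltW lt1)))//.
rewrite -mulrA ler_piMr ?(ltW e0)// ler_pdivrMl ?ltr_wpDl// mulr1.
by rewrite lerDl ler01.
Qed.

(** The orthogonal complement of a finite family [L] is not contained in the
    span of a finite family [s]. *)
Lemma orthogonal_not_finite (dimH : infinite_dimensional H) (L s : seq H) :
  exists x : H, (forall v, v \in L -> ip x v = 0) /\
    forall c : 'I_(size s) -> R[i], x <> \sum_(i < size s) c i *: s`_i.
Proof.
elim: L s => [|v L IH] s; first by have [x xs] := dimH s; exists x.
(* Either some [z] orthogonal to [L] has a nonzero product with [v], and a
   vector outside the span of [z :: s] is corrected along [z]; or every vector
   orthogonal to [L] is already orthogonal to [v]. *)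
have [[z [zL zv]]|noz] := pselect (exists z : H,
    (forall w, w \in L -> ip z w = 0) /\ ip z v != 0); last first.
  have [x [xL xs]] := IH s; exists x; split=> // w.
  rewrite inE => /orP[/eqP->|/xL//]; apply/eqP/negPn/negP => xv.
  by apply: noz; exists x.
have [x [xL xs]] := IH (z :: s).
set a := ip x v / ip z v.
exists (x - a *: z); split=> [w|c cE].
  rewrite inE ipBl ipZl => /orP[/eqP->|wL].
    by rewrite /a divfK// subrr.
  by rewrite xL// zL// mulr0 subr0.
apply: (xs (fun i => oapp c a (unlift ord0 i))).
rewrite big_ord_recl /= unlift_none /=.
under eq_bigr do rewrite liftK /=.
by rewrite -cE addrC subrK.
Qed.

Lemma orthogonal_unit (dimH : infinite_dimensional H) (L : seq H) :
  exists e : H, ip e e = 1 /\ forall v, v \in L -> ip e v = 0.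
Proof.
have [x [xL xs]] := orthogonal_not_finite dimH L [::].
have x0 : `|x| != 0.
  rewrite normr_eq0; apply/eqP => x0.
  by apply: (xs (fun=> 0)); rewrite big_ord0.
exists (`|x|^-1 *: x); split=> [|v vL]; last by rewrite ipZl xL// mulr0.
by rewrite -ip_norm normrZ ger0_norm ?invr_ge0// mulVf// expr1n.
Qed.

(** The harmonic coefficients are square summable, so completeness applies. *)
Lemma harmonic_orthonormal_cvg (e : nat -> H) :
  (forall k, ip (e k) (e k) = 1) ->
  (forall j k, (j < k)%N -> ip (e k) (e j) = 0) ->
  exists x : H, series (fun k => (harmonic k : R)%:C *: e k) @ \oo --> x.
Proof.
move=> ee eo; set u := fun k : nat => (harmonic k : R)%:C *: e k.
suff cu : cvgn (series u) by exists (limn (series u)).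
have ue m n j : (n <= j)%N -> ip (\sum_(m <= k < n) u k) (e j) = 0.
  move=> nj; rewrite ip_suml big_nat big1// => k /andP[_ kn].
  by rewrite /u ipZl ip_conj eo ?(leq_trans kn)// rmorph0 mulr0.
have uu m n : ip (\sum_(m <= k < n) u k) (\sum_(m <= k < n) u k) =
    (\sum_(m <= k < n) (harmonic k : R) ^+ 2)%:C.
  elim: n => [|n IH]; first by rewrite !big_geq// linear0r.
  have [mn|nm] := leqP m n; last by rewrite !big_geq// linear0r.
  rewrite !big_nat_recr//= ip_pythagoras; last by rewrite /u ipZr ue// mulr0.
  rewrite IH {1 2}/u ipZl ipZr ee mulr1 rmorphD rmorphXn expr2.
  congr (_ + _ * _).
  by apply: CrealP; rewrite complex_real.
(* [1 / (k + 1)^2 <= 2 (1 / (k + 1) - 1 / (k + 2))], which telescopes. *)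
have tel m n : (m <= n)%N -> \sum_(m <= k < n) (harmonic k : R) ^+ 2 <=
    2 * harmonic m.
  move=> mn; have : \sum_(m <= k < n) (harmonic k : R) ^+ 2 <=
      2 * (harmonic m - harmonic n).
    rewrite mulrBr -(opprB (2 * harmonic n)).
    rewrite -(telescope_sumr (fun k => 2 * harmonic k : R) mn) -sumrN.
    apply: ler_sum => k _; rewrite opprB -mulrBr /harmonic.
    rewrite -subr_ge0.
    have -> : 2 * (k.+1%:R^-1 - k.+2%:R^-1) - k.+1%:R^-1 ^+ 2 =
      (k%:R : R) / (k.+1%:R ^+ 2 * k.+2%:R).
      have h1 : (k.+1%:R : R) != 0 by rewrite pnatr_eq0.
      have h2 : (k.+2%:R : R) != 0 by rewrite pnatr_eq0.
      by rewrite -!natr1 in h1 h2 *; field; rewrite h1 h2.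
    by rewrite divr_ge0.
  move=> /le_trans; apply; rewrite ler_pM2l// gerBl.
  exact: harmonic_ge0.
apply/cauchy_cvgP/cauchy_seriesP => eps eps0.
have epsE : eps = (rnorm eps)%:C by rewrite -rnormE gtr0_norm.
have d2 : 0 < rnorm eps ^+ 2 / 2.
  by rewrite divr_gt0// exprn_gt0// -(@ltcR R) -epsE.
have /cvgrPdist_lt/(_ _ d2)[N _ HN] := @cvg_harmonic R.
exists ([set n | (N <= n)%N], setT); first by split; [exists N|exact: filterT].
move=> [m n] /= [Nm _].
have [mn|nm] := leqP m n; last by rewrite big_geq ?normr0// ltnW.
rewrite -(@ltr_pXn2r _ 2)// ?nnegrE ?(ltW eps0)//.
rewrite ip_norm uu.
rewrite epsE -rmorphXn ltcR (le_lt_trans (tel _ _ mn))//.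
have := HN _ Nm; rewrite sub0r normrN ger0_norm ?harmonic_ge0//.
by rewrite ltr_pdivlMr// mulrC.
Qed.

End InnerProduct.

(** * The gliding hump *)

(** The norm of the [n]-th term of the expansion of [v] along [x_] with
    coefficients given by [y_]. *)
Definition term_norm {R : realType} {H : completeNormedModType R[i]}
    (ip : {dot H for @Num.conj R[i]}) (x_ y_ : nat -> H) (v : H) (n : nat)
    : R :=
  rnorm (ip v (y_ n) *: x_ n).

Section GlidingHump.
Context {R : realType} {H : completeNormedModType R[i]}.
Context {ip : {dot H for @Num.conj R[i]}} (ip_norm : induces_norm ip).
Context {x_ y_ : nat -> H}.
Local Notation G := (term_norm ip x_ y_).

Lemma term_norm_ge0 (v : H) (n : nat) : 0 <= G v n.
Proof. exact: rnorm_ge0. Qed.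

Lemma term_norm_eq (v w : H) (n : nat) :
  ip v (y_ n) = ip w (y_ n) -> G v n = G w n.
Proof. by rewrite /term_norm => ->. Qed.

Lemma term_norm_eq0 (v : H) (n : nat) : ip v (y_ n) = 0 -> G v n = 0.
Proof. by rewrite /term_norm /rnorm => ->; rewrite scale0r normr0. Qed.

(** The reverse triangle inequality, termwise: adding a small multiple of [e]
    to [s] is felt wherever the terms of [s] are negligible. *)
Lemma term_norm_perturb (s e : H) (c : R) (n : nat) : 0 <= c ->
  c * G e n - G s n <= G (s + c%:C *: e) n.
Proof.
move=> c0; rewrite /term_norm ipDl ipZl scalerDl -scalerA.
rewrite [X in _ <= rnorm X]addrC -rnormZ//; exact: lerB_rnormD.
Qed.

(** One stage of the construction: [E] lists the unit vectors already chosen,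
    [s] is the current partial sum, [c] the coefficient of the new vector
    [p.1], and [p.2] the index that ends the new block. *)
Lemma gliding_hump_step (dimH : infinite_dimensional H)
    (dual : alternative_dual ip x_ y_) (sumG : forall v, cvgn (series (G v)))
    (E : seq H) (s : H) (N : nat) (c d : R) : 0 < d ->
  exists p : H * nat, [/\ ip p.1 p.1 = 1,
    forall v, v \in E ++ mkseq y_ N -> ip p.1 v = 0,
    (N <= p.2)%N, 2^-1 <= \sum_(0 <= n < p.2) G p.1 n &
    forall M, \sum_(p.2 <= n < M) G (s + c%:C *: p.1) n <= d].
Proof.
move=> d0.
have [e [ee eL]] := orthogonal_unit ip_norm dimH (E ++ mkseq y_ N).
have e1 : rnorm e = 1.
  apply: (@complexI R); rewrite -rnormE; apply/eqP.
  by rewrite -(@eqrXn2 _ 2)// ip_norm ee expr1n.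
have half0 : 0 < (2^-1 : R[i]) by [].
have /cvgrPdistC_lt/(_ _ half0)[N1 _ HN1] := dual e.
have /cauchy_cvgP/cauchy_seriesP/(_ _ d0)[[A B] /= [[N2 _ HA] [N3 _ HB]] HAB] :=
  sumG (s + c%:C *: e).
(* Past [N1] the expansion of [e] is within 1/2 of [e]; past [N2] and [N3] the
   tails of [G (s + c *: e)] are less than [d]. *)
set N' := maxn N (maxn N1 (maxn N2 N3)).
exists (e, N'); split => //=.
- exact: leq_maxl.
- have := HN1 N' ltac:(by rewrite /= /N' !leq_max leqnn !orbT).
  rewrite /= rnormE => lt1.
  have := rnorm_sum _ _ (index_iota 0 N') xpredT (fun n => ip e (y_ n) *: x_ n).
  apply: le_trans.
  have := lerB_rnormD _ e (series (fun n => ip e (y_ n) *: x_ n) N' - e).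
  rewrite (addrC e) subrK e1.
  have {lt1} : rnorm (series (fun n => ip e (y_ n) *: x_ n) N' - e) < 2^-1.
    by rewrite -(@ltcR R) fmorphV rmorph_nat.
  rewrite /series /=; lra.
- move=> M; have [MN|NM] := leqP M N'; first by rewrite big_geq// ltW.
  have N2N : (N2 <= N')%N by rewrite /N' !leq_max leqnn !orbT.
  have N3M : (N3 <= M)%N.
    by apply: leq_trans (ltnW NM); rewrite /N' !leq_max leqnn !orbT.
  have := HAB (N', M) (conj (HA _ N2N) (HB _ N3M)) => /= h.
  exact: le_trans (ler_norm _) (ltW h).
Qed.

(** The sequence of humps: [s k] is the partial sum built before stage [k],
    and the block of stage [k] is [N k <= n < N k.+1]. *)
Lemma gliding_hump_sequence (dimH : infinite_dimensional H)
    (dual : alternative_dual ip x_ y_) (sumG : forall v, cvgn (series (G v))) :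
  exists (e : nat -> H) (N : nat -> nat),
  let s := series (fun k => (harmonic k : R)%:C *: e k) in
  [/\ (forall k, ip (e k) (e k) = 1),
      (forall j k, (j < k)%N -> ip (e k) (e j) = 0) &
      forall k, [/\ forall n, (n < N k)%N -> ip (e k) (y_ n) = 0,
        (N k <= N k.+1)%N,
        2^-1 <= \sum_(0 <= n < N k.+1) G (e k) n &
        forall M, \sum_(N k <= n < M) G (s k) n <= 4^-1 * harmonic k]].
Proof.
(* A state [t] consists of the stage, the list of previous unit vectors, the
   partial sum and the current index. *)
pose P (t : nat * (seq H * H * nat)) (p : H * nat) :=
  [/\ ip p.1 p.1 = 1,
    forall v, v \in t.2.1.1 ++ mkseq y_ t.2.2 -> ip p.1 v = 0,
    (t.2.2 <= p.2)%N, 2^-1 <= \sum_(0 <= n < p.2) G p.1 n &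
    forall M, \sum_(p.2 <= n < M) G (t.2.1.2 + (harmonic t.1)%:C *: p.1) n
      <= 4^-1 * harmonic t.1.+1].
have [f fP] : {f & forall t, P t (f t)}.
  apply: boolp.choice => t; apply: gliding_hump_step => //.
  by rewrite mulr_gt0 ?harmonic_gt0// invr_gt0.
pose st := fix st k := if k is k'.+1 then
    let t := st k' in let p := f (k', t) in
    (p.1 :: t.1.1, t.1.2 + (harmonic k')%:C *: p.1, p.2)
  else ([::], 0, 0%N).
pose e k := (f (k, st k)).1; pose N k := (st k).2.
have stE k : (st k).1.2 = series (fun k => (harmonic k : R)%:C *: e k) k.
  elim: k => [|k IH]; first by rewrite /series /= big_geq.
  by rewrite seriesSr -IH.
have stM j k : (j < k)%N -> e j \in (st k).1.1.
  elim: k => // k IH; rewrite ltnS leq_eqVlt inE => /orP[/eqP->|/IH->].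
    by rewrite eqxx.
  by rewrite orbT.
exists e, N; split.
- by move=> k; have [] := fP (k, st k).
- move=> j k /stM ej; have [_ + _ _ _] := fP (k, st k); apply.
  by rewrite mem_cat ej.
- move=> k; have [_ h1 h2 h3 _] := fP (k, st k); split => //.
    move=> n nN; apply: h1; rewrite mem_cat; apply/orP; right; apply/mapP.
    by exists n; rewrite ?mem_iota.
  case: k {h1 h2 h3} => [|k] M.
    rewrite big1 ?mulr_ge0 ?harmonic_ge0 ?invr_ge0// => n _.
    by apply: term_norm_eq0; rewrite /series /= big_geq// linear0l.
  by rewrite -stE; have [_ _ _ _] := fP (k, st k); apply.
Qed.

(** No alternative dual, of any sequence [x_], yields expansions that all
    converge absolutely. *)
Lemma no_absolutely_summing_dual (dimH : infinite_dimensional H)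
    (dual : alternative_dual ip x_ y_) (sumG : forall v, cvgn (series (G v))) :
  False.
Proof.
have [e [N []]] := gliding_hump_sequence dimH dual sumG.
set u := fun k => _ *: e k => ee eo P.
have [x sx] := harmonic_orthonormal_cvg ip_norm e ee eo.
have Nmono k m : (k <= m)%N -> (N k <= N m)%N.
  apply: (@homo_leq _ N leq) => // [? ? ?|i]; first exact: leq_trans.
  by have [] := P i.
(* The later [e m] are orthogonal to [y_ n] for [n < N k], so the limit and the
   partial sum of order [k] have the same [n]-th term. *)
have xs k n : (n < N k)%N -> G x n = G (series u k) n.
  move=> nk; apply: term_norm_eq; apply: (ip_cvg_const ip_norm _ _ _ _ k sx).
  elim=> [|m IH]; first by rewrite leqn0 => /eqP->.
  rewrite leq_eqVlt => /orP[/eqP->//|]; rewrite ltnS => km.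
  rewrite seriesSr ipDl IH// {2}/u ipZl.
  have [-> //] := P m; first by rewrite mulr0 addr0.
  exact: leq_trans nk (Nmono _ _ km).
have block k : 4^-1 * harmonic k <= \sum_(N k <= n < N k.+1) G x n.
  have [h1 h2 h3 h4] := P k.
  have : \sum_(N k <= n < N k.+1) (harmonic k * G (e k) n - G (series u k) n)
      <= \sum_(N k <= n < N k.+1) G x n.
    rewrite big_nat [leRHS]big_nat; apply: ler_sum => n /andP[_ nk].
    by rewrite (xs k.+1)// seriesSr; exact/term_norm_perturb/harmonic_ge0.
  apply: le_trans; rewrite sumrB -mulr_sumr.
  move: h3; rewrite (@big_cat_nat _ _ _ (N k))//= big_nat big1 ?add0r;
    last first.
    by move=> n /andP[_ nk]; rewrite term_norm_eq0 ?h1.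
  move=> /(ler_wpM2l (harmonic_ge0 k)) h3; have {}h4 := h4 (N k.+1).
  rewrite /harmonic /= in h3 h4; set c := k.+1%:R^-1 in h3 h4 *.
  by rewrite lerBrDr (le_trans _ h3)//; lra.
have [M hM] : exists M, forall n, \sum_(0 <= i < n) G x i <= M.
  exists (limn (series (G x))) => n.
  apply: (nondecreasing_cvgn_le _ (sumG x)).
  apply: nondecreasing_series => *; exact: term_norm_ge0.
apply: (@dvg_harmonic R); apply: nondecreasing_is_cvgn.
  by apply: nondecreasing_series => *; exact: harmonic_ge0.
exists (4 * M) => _ [k _ <-].
rewrite -ler_pdivrMl//.
apply: le_trans (hM (N k)).
elim: k => [|k IH].
  rewrite /series /= big_geq// mulr0 sumr_ge0// => *.
  exact: term_norm_ge0.
rewrite seriesSr mulrDr (@big_cat_nat _ _ _ (N k))//=; last exact: Nmono.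
exact: lerD IH (block k).
Qed.

End GlidingHump.

Theorem theorem5p3 (R : realType) (H : completeNormedModType R[i])
    (ip : {dot H for @Num.conj R[i]})
    (ip_norm : induces_norm ip)
    (sepH : separable_space H)
    (dimH : infinite_dimensional H) :
  ~ exists x_ : nat -> H, absolutely_convergent_frame ip x_.
Proof.
move=> [x_ [_ _ [y_ dual summable]]].
apply: (no_absolutely_summing_dual ip_norm dimH dual) => v.
apply: nnseries_is_cvg => [n|]; first exact: term_norm_ge0.
have := summable v.
by under eq_eseriesr do rewrite powRr1 ?rnorm_ge0//.
Qed.
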